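(* Consider the scenario-oriented energy-reserve co-optimization model (II) described in the context, together with an optimal primal solution and associated optimal Lagrange multipliers. For any given scenario $k\in\mathcal K$ and any two generators $i,j$ at the same bus ($m_i=m_j$) with $\delta g^U_k(i)>0$ and $\delta g^U_k(j)>0$, $$\frac{\Pi^U_k(i)}{\delta g^U_k(i)}=\frac{\Pi^U_k(j)}{\delta g^U_k(j)}=\omega_k(m_i)=\omega_k(m_j),$$ where all quantities are evaluated at the optimal solution.
   Context: Model (II). There are finitely many buses, generators $j$ (located at bus $m_j$), loads $l$ (located at bus $m_l$), and a finite set $\mathcal K$ of mutually exclusive non-base scenarios with given occurrence probabilities $\epsilon_k>0$, $\sum_{k\in\mathcal K}\epsilon_k\le 1$. The setting is single-period, lossless DC power flow; renewables are treated as negative loads; non-base scenarios may contain line outages and load fluctuations but no generator outages. Decision variables: generation $g$, upward reserve $r_U$, downward reserve $r_D$ (vectors over generators), and for each $k\in\mathcal K$ upward/downward re-dispatch $\delta g^U_k,\delta g^D_k$ (over generators) and load shedding $\delta d_k$ (over loads). Data: bid-in prices $c_g,c_U,c_D$, re-dispatch prices $\overline c,\underline c$, load-shedding prices $c_L$, base load $d$, load fluctuation $\pi_k$ (with $d+\pi_k\ge 0$), generation bounds $\underline G,\overline G$, reserve bounds $\overline{r_U},\overline{r_D}$, line limits $f$ (base) and $f_k$ (scenario $k$), shift-factor matrices $S_G,S_D$ (base) and $S_{G,k},S_{D,k}$ (scenario $k$) for generators and loads. Model (II) is the linear program $$\min\; F=c_g^Tg+c_U^Tr_U+c_D^Tr_D+\sum_{k\in\mathcal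 K}\epsilon_k(\overline c^T\delta g^U_k-\underline c^T\delta g^D_k+c_L^T\delta d_k)$$ subject to (multipliers in front) $(\lambda,\mu)$: $\mathbf 1^Tg=\mathbf 1^Td$, $S_Gg-S_Dd\le f$; $(\underline\upsilon,\overline\upsilon)$: $\underline G+r_D\le g$, $g+r_U\le\overline G$; $(\underline{\rho^U},\overline{\rho^U},\underline{\rho^D},\overline{\rho^D})$: $0\le r_U\le\overline{r_U}$, $0\le r_D\le\overline{r_D}$; and for all $k\in\mathcal K$: $\lambda_k$: $\mathbf 1^T(g+\delta g^U_k-\delta g^D_k)=\mathbf 1^T(d+\pi_k-\delta d_k)$; $\mu_k$: $S_{G,k}(g+\delta g^U_k-\delta g^D_k)-S_{D,k}(d+\pi_k-\delta d_k)\le f_k$; $(\underline{\alpha_k},\overline{\alpha_k})$: $0\le\delta g^U_k\le r_U$; $(\underline{\beta_k},\overline{\beta_k})$: $0\le\delta g^D_k\le r_D$; $(\underline{\tau_k},\overline{\tau_k})$: $0\le\delta d_k\le d+\pi_k$. Sign convention: the Lagrangian is $F$ plus $\lambda(\mathbf 1^Td-\mathbf 1^Tg)$, plus $\lambda_k(\mathbf 1^T(d+\pi_k-\delta d_k)-\mathbf 1^T(g+\delta g^U_k-\delta g^D_k))$ for each $k$, plus, for each inequality $a\le b$, its nonnegative multiplier times $(a-b)$. It is assumed that (II) has an optimal solution; superscript $*$ denotes optimal values and multipliers, fixed throughout. Shift factors depend only on the bus: $S_{G,k}(\cdot,m_j)$ denotes the column of $S_{G,k}$ for a generator at bus $m_j$,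 which is the column for that bus of a bus shift-factor matrix, so generators at the same bus have the same column. For a bus $m$, $\omega_k(m)=\lambda_k^*-S_{G,k}(\cdot,m)^T\mu_k^*$. Fractional revenue: the contribution of scenario $k$ to generator $j$'s upward reserve credit is $\Gamma^U_k(j)=\overline{\alpha_k}^*(j)\,r_U(j)$; the ex-post upward re-dispatch credit of $j$ if scenario $k$ is realized is $\Phi^U_k(j)=\overline c(j)\,\delta g^U_k(j)$; and $\Pi^U_k(j)=\Gamma^U_k(j)+\epsilon_k\Phi^U_k(j)$. *)

(* Defs.v *)
From mathcomp Require Import all_boot all_order all_algebra.
From mathcomp Require Import classical_sets reals constructive_ereal ereal.

Set Implicit Arguments.
Unset Strict Implicit.
Unset Printing Implicit Defensive.

Import Order.TTheory GRing.Theory Num.Theory.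
Local Open Scope ring_scope.

Section Vectors.
Variables (R : realType) (n : nat).
Implicit Types u v : 'cV[R]_n.

Definition dot u v : R := (u^T *m v) 0 0.

Definition total v : R := \sum_(i < n) v i 0.

Definition lev u v : Prop := forall i, u i 0 <= v i 0.

End Vectors.

Notation "u <=v v" := (lev u v) (at level 70, no associativity) : ring_scope.

(* Suffix [_s]: data, decisions and multipliers of a non-base scenario.
   A scenario may have its own list of monitored lines, hence [nline_s].
   Shift factors are stored per bus; the matrices over generators and loads
   that enter the constraints are obtained below by selecting columns. *)
Record model (R : realType) := Model {
  nbus : nat;
  ngen : nat;
  nload : nat;
  nline : nat;
  scenario : finType;
  nline_s : scenario -> nat;

  gbus : 'I_ngen -> 'I_nbus;
  lbus : 'I_nload -> 'I_nbus;

  prob : scenario -> R;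
  prob_gt0 : forall k, 0 < prob k;
  prob_sum : \sum_k prob k <= 1;

  cg : 'cV[R]_ngen;
  cU : 'cV[R]_ngen;
  cD : 'cV[R]_ngen;
  cup : 'cV[R]_ngen;   (* upward re-dispatch price, written c with an overbar *)
  cdn : 'cV[R]_ngen;   (* downward re-dispatch price, c with an underbar *)
  cL : 'cV[R]_nload;

  load : 'cV[R]_nload;
  fluct : scenario -> 'cV[R]_nload;
  load_s_ge0 : forall k, 0 <=v load + fluct k;

  Gmin : 'cV[R]_ngen;
  Gmax : 'cV[R]_ngen;
  rUmax : 'cV[R]_ngen;
  rDmax : 'cV[R]_ngen;

  flim : 'cV[R]_nline;
  flim_s : forall k, 'cV[R]_(nline_s k);

  shiftG : 'M[R]_(nline, nbus);
  shiftD : 'M[R]_(nline, nbus);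
  shiftG_s : forall k, 'M[R]_(nline_s k, nbus);
  shiftD_s : forall k, 'M[R]_(nline_s k, nbus)
}.

Record decision (R : realType) (M : model R) := Decision {
  gen : 'cV[R]_(ngen M);
  rU : 'cV[R]_(ngen M);
  rD : 'cV[R]_(ngen M);
  dgU : scenario M -> 'cV[R]_(ngen M);
  dgD : scenario M -> 'cV[R]_(ngen M);
  shed : scenario M -> 'cV[R]_(nload M)
}.

(* Suffixes [lo] and [up]: multipliers of lower and upper bounds. *)
Record multipliers (R : realType) (M : model R) := Multipliers {
  lam : R;
  mu : 'cV[R]_(nline M);
  ups_lo : 'cV[R]_(ngen M);
  ups_up : 'cV[R]_(ngen M);
  rhoU_lo : 'cV[R]_(ngen M);
  rhoU_up : 'cV[R]_(ngen M);
  rhoD_lo : 'cV[R]_(ngen M);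
  rhoD_up : 'cV[R]_(ngen M);
  lam_s : scenario M -> R;
  mu_s : forall k : scenario M, 'cV[R]_(nline_s k);
  alpha_lo : scenario M -> 'cV[R]_(ngen M);
  alpha_up : scenario M -> 'cV[R]_(ngen M);
  beta_lo : scenario M -> 'cV[R]_(ngen M);
  beta_up : scenario M -> 'cV[R]_(ngen M);
  tau_lo : scenario M -> 'cV[R]_(nload M);
  tau_up : scenario M -> 'cV[R]_(nload M)
}.

Section ModelII.
Variables (R : realType) (M : model R).
Implicit Types (x : decision M) (y : multipliers M) (k : scenario M).

Definition SG : 'M[R]_(nline M, ngen M) := colsub (@gbus R M) (shiftG M).
Definition SD : 'M[R]_(nline M, nload M) := colsub (@lbus R M) (shiftD M).
Definition SG_s k : 'M[R]_(nline_s k, ngen M) :=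
  colsub (@gbus R M) (shiftG_s k).
Definition SD_s k : 'M[R]_(nline_s k, nload M) :=
  colsub (@lbus R M) (shiftD_s k).

Definition gen_s x k : 'cV[R]_(ngen M) := gen x + dgU x k - dgD x k.
Definition load_s x k : 'cV[R]_(nload M) := load M + fluct k - shed x k.

Definition cost x : R :=
  dot (cg M) (gen x) + dot (cU M) (rU x) + dot (cD M) (rD x)
  + \sum_k prob k * (dot (cup M) (dgU x k) - dot (cdn M) (dgD x k)
                     + dot (cL M) (shed x k)).

Record feasible_base x : Prop := FeasibleBase {
  base_balance : total (gen x) = total (load M);
  base_lines : SG *m gen x - SD *m load M <=v flim M;
  gen_ge : Gmin M + rD x <=v gen x;
  gen_le : gen x + rU x <=v Gmax M;
  rU_ge0 : 0 <=v rU x;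
  rU_le : rU x <=v rUmax M;
  rD_ge0 : 0 <=v rD x;
  rD_le : rD x <=v rDmax M
}.

Record feasible_scenario x k : Prop := FeasibleScenario {
  scen_balance : total (gen_s x k) = total (load_s x k);
  scen_lines : SG_s k *m gen_s x k - SD_s k *m load_s x k <=v flim_s k;
  dgU_ge0 : 0 <=v dgU x k;
  dgU_le : dgU x k <=v rU x;
  dgD_ge0 : 0 <=v dgD x k;
  dgD_le : dgD x k <=v rD x;
  shed_ge0 : 0 <=v shed x k;
  shed_le : shed x k <=v load M + fluct k
}.

Definition feasible x : Prop :=
  feasible_base x /\ forall k, feasible_scenario x k.

Definition primal_optimal x : Prop :=
  feasible x /\ forall x', feasible x' -> cost x <= cost x'.

Definition lagrangian_base x y : R :=
  lam y * (total (load M) - total (gen x))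
  + dot (mu y) (SG *m gen x - SD *m load M - flim M)
  + dot (ups_lo y) (Gmin M + rD x - gen x)
  + dot (ups_up y) (gen x + rU x - Gmax M)
  + dot (rhoU_lo y) (0 - rU x)
  + dot (rhoU_up y) (rU x - rUmax M)
  + dot (rhoD_lo y) (0 - rD x)
  + dot (rhoD_up y) (rD x - rDmax M).

Definition lagrangian_scenario x y k : R :=
  lam_s y k * (total (load_s x k) - total (gen_s x k))
  + dot (mu_s y k) (SG_s k *m gen_s x k - SD_s k *m load_s x k - flim_s k)
  + dot (alpha_lo y k) (0 - dgU x k)
  + dot (alpha_up y k) (dgU x k - rU x)
  + dot (beta_lo y k) (0 - dgD x k)
  + dot (beta_up y k) (dgD x k - rD x)
  + dot (tau_lo y k) (0 - shed x k)
  + dot (tau_up y k) (shed x k - (load M + fluct k)).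

Definition lagrangian x y : R :=
  cost x + lagrangian_base x y + \sum_k lagrangian_scenario x y k.

Record dual_feasible y : Prop := DualFeasible {
  mu_ge0 : 0 <=v mu y;
  ups_lo_ge0 : 0 <=v ups_lo y;
  ups_up_ge0 : 0 <=v ups_up y;
  rhoU_lo_ge0 : 0 <=v rhoU_lo y;
  rhoU_up_ge0 : 0 <=v rhoU_up y;
  rhoD_lo_ge0 : 0 <=v rhoD_lo y;
  rhoD_up_ge0 : 0 <=v rhoD_up y;
  mu_s_ge0 : forall k, 0 <=v mu_s y k;
  alpha_lo_ge0 : forall k, 0 <=v alpha_lo y k;
  alpha_up_ge0 : forall k, 0 <=v alpha_up y k;
  beta_lo_ge0 : forall k, 0 <=v beta_lo y k;
  beta_up_ge0 : forall k, 0 <=v beta_up y k;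
  tau_lo_ge0 : forall k, 0 <=v tau_lo y k;
  tau_up_ge0 : forall k, 0 <=v tau_up y k
}.

(* The infimum is over all decisions, feasible or not; it may be -oo. *)
Definition dual_value y : \bar R :=
  ereal_inf (range (fun x => (lagrangian x y)%:E)).

(* Optimal Lagrange multipliers are the solutions of the dual program. *)
Definition dual_optimal y : Prop :=
  dual_feasible y /\
  forall y', dual_feasible y' -> (dual_value y' <= dual_value y)%E.

Definition omega y k (m : 'I_(nbus M)) : R :=
  lam_s y k - dot (col m (shiftG_s k)) (mu_s y k).

Definition GammaU x y k (j : 'I_(ngen M)) : R := alpha_up y k j 0 * rU x j 0.

Definition PhiU x k (j : 'I_(ngen M)) : R := cup M j 0 * dgU x k j 0.

Definition PiU x y k (j : 'I_(ngen M)) : R :=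
  GammaU x y k j + prob k * PhiU x k j.

End ModelII.

(* Main.v *)
(* Linear programming duality, obtained from Farkas' lemma, shows that an
   optimal dual vector [y] satisfies [cost x <= lagrangian x' y] for every
   decision [x'].  At [x' = x] this forces complementary slackness.
   Perturbing the upward re-dispatch of generator [i] in scenario [k] by +1
   and -1 makes the slope of the Lagrangian in that direction vanish, that is,
   [prob k * cup i + alpha_up i - alpha_lo i = omega k (gbus i)].  When
   [dgU i > 0], slackness gives [alpha_lo i = 0] and
   [alpha_up i * rU i = alpha_up i * dgU i], so [PiU i / dgU i] equals
   [omega k (gbus i)], which depends only on the bus of [i]. *)

Require Import Defs.
From mathcomp Require Import all_boot all_order all_algebra.
From mathcomp Require Import ring lra.
From mathcomp Require Import boolp functions.
From mathcomp Require Import classical_sets reals constructive_ereal ereal.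

Set Implicit Arguments.
Unset Strict Implicit.
Unset Printing Implicit Defensive.

Import Order.TTheory GRing.Theory Num.Theory.
Local Open Scope ring_scope.

(** * Farkas' lemma for finitely many linear functionals *)

(* Bartl's induction: if [a i0] cannot be dropped, some [w] has [a i w <= 0]
   for the other [i] but [c w > 0], so [a i0 w > 0]; composing every
   functional with the projection along [w] onto the kernel of [a i0] removes
   the constraint [i0]. *)
Lemma farkas (R : realFieldType) (V : lmodType R) (I : eqType) (s : seq I)
    (a : I -> V -> R) (c : V -> R) :
  uniq s -> (forall i, scalar (a i)) -> scalar c ->
  (forall v, {in s, forall i, a i v <= 0} -> c v <= 0) ->
  exists2 y : I -> R, forall i, 0 <= y i &
    forall v, c v = \sum_(i <- s) y i * a i v.
Proof.
have scalarB (f : V -> R) (v w : V) (t : R) :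
    scalar f -> f (v - t *: w) = f v - t * f w.
  by move=> lf; rewrite addrC -scaleNr lf mulNr addrC.
elim: s a c => [|i0 s IHs] a c /= => [_ _ lc c_le0|/andP[i0s us] la lc c_le0].
  exists (fun=> 0) => // v; rewrite big_nil; apply/eqP.
  have c0 : c 0 = 0.
    by rewrite -[0 in LHS](subrr 0) -[X in _ - X]scale1r scalarB // mul1r subrr.
  (* Without constraints [c] is nonpositive at [v] and at [- v], hence zero. *)
  have : c (0 - 1 *: v) <= 0 by apply: c_le0.
  by rewrite scalarB // c0 mul1r sub0r oppr_le0 eq_le c_le0 // => ->.
case: (pselect (forall v, {in s, forall i, a i v <= 0} -> c v <= 0)).
  case/(IHs a c us la lc) => y y_ge0 cE.
  exists (fun i => if i == i0 then 0 else y i) => [i|v]; first by case: ifP.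
  rewrite big_cons eqxx mul0r add0r cE; apply: eq_big_seq => i is_.
  by case: eqP i0s is_ => // -> /negP.
case/existsNP => w /not_implyP[w_le0 /negP]; rewrite -ltNge => cw_gt0.
have aw_gt0 : 0 < a i0 w.
  rewrite ltNge; apply: contraL cw_gt0 => aw_le0; rewrite -leNgt.
  by apply: c_le0 => i /[!inE] /orP[/eqP->|/w_le0].
pose p v := v - (a i0 v / a i0 w) *: w.
have scalar_p (f : V -> R) : scalar f -> scalar (f \o p).
  move=> lf t u v /=; rewrite !scalarB // lf la; ring.
have [i||v pv_le0|y y_ge0 cE] := IHs (fun i => a i \o p) (c \o p) us.
- exact: scalar_p.
- exact: scalar_p.
(* Since [a i0 (p v) = 0], the point [p v] also satisfies the constraint [i0]. *)
- apply: c_le0 => i /[!inE] /orP[/eqP->|/pv_le0 //].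
  by rewrite scalarB // divfK ?subrr // gt_eqF.
(* Evaluating the wanted identity at [w] forces this value; it is nonnegative because [c w > 0],
   [a i0 w > 0] and every [y i * a i w] is at most 0. *)
pose z := (c w - \sum_(i <- s) y i * a i w) / a i0 w.
exists (fun i => if i == i0 then z else y i) => [i|v].
  case: ifP => // _; apply: divr_ge0 (ltW aw_gt0).
  rewrite subr_ge0 (le_trans _ (ltW cw_gt0)) // big_seq sumr_le0 // => k ks.
  by rewrite mulr_ge0_le0 ?w_le0.
rewrite big_cons eqxx.
(* By uniqueness [i0] is not in [s], so overriding its multiplier leaves the tail unchanged. *)
rewrite (_ : \sum_(i <- s) _ = \sum_(i <- s) y i * a i v); last first.
  by apply: eq_big_seq => i is_; case: eqP i0s is_ => // -> /negP.
have := cE v; rewrite /= scalarB //.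
under eq_bigr => i _ do rewrite scalarB // mulrBr mulrCA.
rewrite sumrB -mulr_sumr /z => /(canRL (subrK _)) ->; ring.
Qed.

(** * Lagrange duality for affine programs *)

(** This form needs no origin and no separate linear part, so constants and projections are handled
    alike. *)
Definition affine (R : pzRingType) (V W : lmodType R) (f : V -> W) :=
  forall t u v w, f (t *: (u - w) + v) = t *: (f u - f w) + f v.

Lemma affine_shift (R : pzRingType) (V W : lmodType R) (f : V -> W) u t d :
  affine f -> f (u + t *: d) = f u + t *: (f (u + d) - f u).
Proof.
by move=> af; rewrite -{1}[d](addKr u) addrC [- u + _]addrC af addrC.
Qed.

(** A direction that increases no constraint active at [u] can be followed for a short step without
    leaving the feasible set, so by minimality it does not lower the cost. Farkas' lemma, applied to
    the increments of the active constraints, turns this into multipliers. *)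
Lemma affine_duality (R : realFieldType) (V : lmodType R) (I : finType)
    (g : I -> V -> R^o) (c : V -> R^o) (u : V) :
  (forall i, affine (g i)) -> affine c -> (forall i, g i u <= 0) ->
  (forall v, (forall i, g i v <= 0) -> c u <= c v) ->
  exists2 y : I -> R, forall i, 0 <= y i &
    forall v, c u <= c v + \sum_i y i * g i v.
Proof.
move=> ag ac gu_le0 u_min.
have scalar_lin (f : V -> R^o) : affine f -> scalar (fun d => f (u + d) - f u).
  move=> af t d e /=.
  have -> : u + (t *: d + e) = t *: ((u + d) - u) + (u + e).
    by rewrite [u + d]addrC addrK addrCA.
  by rewrite af -addrA.
pose a i d : R := g i (u + d) - g i u.
pose b d : R := c u - c (u + d).
have [|i|t d e|d d_le0|y y_ge0 bE] :=
  @farkas _ _ _ (enum [pred i | g i u == 0]) a b.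
- exact: enum_uniq.
- exact: scalar_lin.
- have := scalar_lin _ ac t d e; rewrite /b; lra.
(* As [r] exceeds every [|a i d / g i u|], a step of length [r^-1] along [d] keeps the inactive
   constraints satisfied. Quotients with [g i u = 0] are 0 by convention and do no harm. *)
- pose r := 1 + \sum_i `|a i d / g i u|.
  have r_gt0 : 0 < r by rewrite ltr_pwDl ?sumr_ge0.
  have : c u <= c (u + r^-1 *: d).
    apply: u_min => i; rewrite affine_shift // -[g i (u + d) - g i u]/(a i d).
    have [gi0|gi0] := eqVneq (g i u) 0.
      rewrite gi0 add0r; apply: mulr_ge0_le0; first by rewrite invr_ge0 ltW.
      by apply: d_le0; rewrite mem_enum inE gi0.
    have gi_lt0 : g i u < 0 by rewrite lt_neqAle gi0 gu_le0.
    rewrite -(pmulr_rle0 _ r_gt0) mulrDr [_ *: _]mulrC mulrCA divff ?gt_eqF //.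
    rewrite mulr1 -[a i d](divfK gi0) -mulrDl mulr_ge0_le0 //.
    have := ler_norm (- (a i d / g i u)); rewrite normrN /r (bigD1 i) //=.
    have : 0 <= \sum_(j | j != i) `|a j d / g j u| by rewrite sumr_ge0.
    lra.
  rewrite affine_shift // lerDl pmulr_rge0 ?invr_gt0 // /b; lra.
(* Inactive constraints get multiplier 0; for active ones [a i (v - u) = g i v], so the Farkas
   identity at [v - u] yields the claim. *)
exists (fun i => if g i u == 0 then y i else 0) => [i|v]; first by case: ifP.
have := bE (v - u); rewrite /b [u + _]addrC subrK big_enum /=.
move=> /(canRL (subrK _)) ->.
rewrite [X in X + c v](_ : _ = \sum_i (if g i u == 0 then y i else 0) * g i v).
  by rewrite addrC.
rewrite big_mkcond; apply: eq_bigr => i _; rewrite /a [u + _]addrC subrK.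
by rewrite inE; case: eqP => [->|_]; rewrite ?subr0 ?mul0r.
Qed.

(** * Closure properties of affine maps *)

Section AffineMaps.
Variables (R : comPzRingType) (V : lmodType R).
Implicit Types W : lmodType R.

Lemma affine_cst W (w : W) : affine (fun _ : V => w).
Proof. by move=> t u v w'; rewrite subrr scaler0 add0r. Qed.

Lemma affine_comp W W' (h : {linear W -> W'}) (f : V -> W) :
  affine f -> affine (h \o f).
Proof. by move=> af t u v w /=; rewrite af linearP linearB. Qed.

Lemma affineD W (f g : V -> W) :
  affine f -> affine g -> affine (fun v => f v + g v).
Proof.
move=> af ag t u v w; rewrite af ag opprD [f u + _ + _]addrACA.
by rewrite [in RHS]scalerDr addrACA.
Qed.

Lemma affineN W (f : V -> W) : affine f -> affine (fun v => - f v).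
Proof. by move=> af t u v w; rewrite af opprD -scalerN opprD. Qed.

Lemma affineB W (f g : V -> W) :
  affine f -> affine g -> affine (fun v => f v - g v).
Proof. by move=> af ag; apply: affineD => //; apply: affineN. Qed.

Lemma affineZ W a (f : V -> W) : affine f -> affine (fun v => a *: f v).
Proof. exact: (affine_comp ( *:%R a)). Qed.

Lemma affine_sum W (I : finType) (f : I -> V -> W) :
  (forall i, affine (f i)) -> affine (fun v => \sum_i f i v).
Proof.
move=> af t u v w; rewrite -sumrB scaler_sumr -big_split.
by apply: eq_bigr => i _; rewrite af.
Qed.

Lemma affine_mulmx m n (A : 'M[R]_(m, n)) (f : V -> 'cV[R]_n) :
  affine f -> affine (fun v => A *m f v).
Proof. exact: (affine_comp (mulmx A)). Qed.

Lemma affine_col_mx m n (f : V -> 'cV[R]_m) (g : V -> 'cV[R]_n) :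
  affine f -> affine g -> affine (fun v => col_mx (f v) (g v)).
Proof.
move=> af ag t u v w; rewrite af ag -add_col_mx -scale_col_mx.
by rewrite -add_col_mx -opp_col_mx.
Qed.

Lemma affine_const_mx m n (f : V -> R^o) :
  affine f -> affine (fun v => const_mx (f v) : 'M[R]_(m, n)).
Proof. by move=> af t u v w; apply/matrixP => i j; rewrite af !mxE. Qed.

Lemma affine_entry m n (f : V -> 'M[R]_(m, n)) i j :
  affine f -> affine (fun v => f v i j : R^o).
Proof. by move=> af t u v w; rewrite af !mxE. Qed.

Lemma affine_id : affine (fun v : V => v).
Proof. by []. Qed.

Lemma affine_fst W W' (f : V -> (W * W')%type) :
  affine f -> affine (fun v => (f v).1).
Proof. by move=> af t u v w; rewrite af. Qed.

Lemma affine_snd W W' (f : V -> (W * W')%type) :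
  affine f -> affine (fun v => (f v).2).
Proof. by move=> af t u v w; rewrite af. Qed.

Lemma affine_app W (T : Type) (f : V -> T -> W) (k : T) :
  affine f -> affine (fun v => f v k).
Proof. by move=> af t u v w; rewrite af. Qed.

End AffineMaps.

(** * Dot products and the componentwise order *)

Section VectorFacts.
Variables (R : realType).

Lemma addr_le0 (a b : R) : a <= 0 -> b <= 0 -> a + b <= 0.
Proof. by move=> a0 b0; rewrite -[leRHS]addr0 lerD. Qed.

Lemma dotE n (u v : 'cV[R]_n) : dot u v = \sum_i u i 0 * v i 0.
Proof. by rewrite /dot mxE; apply: eq_bigr => i _; rewrite mxE. Qed.

Lemma dotC n (u v : 'cV[R]_n) : dot u v = dot v u.
Proof. by rewrite !dotE; apply: eq_bigr => i _; rewrite mulrC. Qed.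

Lemma dotDr n (u v w : 'cV[R]_n) : dot u (v + w) = dot u v + dot u w.
Proof. by rewrite /dot mulmxDr mxE. Qed.

Lemma dotNr n (u v : 'cV[R]_n) : dot u (- v) = - dot u v.
Proof. by rewrite /dot mulmxN mxE. Qed.

Lemma dotZr n a (u v : 'cV[R]_n) : dot u (a *: v) = a * dot u v.
Proof. by rewrite /dot -scalemxAr mxE. Qed.

Lemma dot_delta n (u : 'cV[R]_n) i : dot u (delta_mx i 0) = u i 0.
Proof. by rewrite /dot -colE !mxE. Qed.

Lemma dot_mulmxr m n (u : 'cV[R]_m) (A : 'M[R]_(m, n)) i :
  dot u (A *m delta_mx i 0) = dot (col i A) u.
Proof. by rewrite dotC -colE. Qed.

Lemma dot_col_mx m n (u : 'cV[R]_(m + n)) (v : 'cV[R]_m) (w : 'cV[R]_n) :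
  dot u (col_mx v w) = dot (usubmx u) v + dot (dsubmx u) w.
Proof.
rewrite -{1}[u]vsubmxK !dotE big_split_ord /=.
by congr (_ + _); apply: eq_bigr => i _; rewrite ?col_mxEu ?col_mxEd.
Qed.

Lemma dot_const_mx1 (u : 'cV[R]_1) a : dot u (const_mx a) = u 0 0 * a.
Proof. by rewrite dotE big_ord1 mxE. Qed.

Lemma dot_le0 n (u v : 'cV[R]_n) : 0 <=v u -> v <=v 0 -> dot u v <= 0.
Proof.
move=> u_ge0 v_le0; rewrite dotE; apply: sumr_le0 => i _.
by apply: mulr_ge0_le0; [have := u_ge0 i | have := v_le0 i]; rewrite mxE.
Qed.

(** A sum of nonpositive terms that is nonnegative has only zero terms; this yields complementary
    slackness component by component. *)
Lemma dot_eq0 n (u v : 'cV[R]_n) i :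
  0 <=v u -> v <=v 0 -> 0 <= dot u v -> u i 0 * v i 0 = 0.
Proof.
move=> u_ge0 v_le0 uv_ge0.
have term_le0 k : u k 0 * v k 0 <= 0.
  by apply: mulr_ge0_le0; [have := u_ge0 k | have := v_le0 k]; rewrite mxE.
apply/eqP; rewrite eq_le term_le0 /= (le_trans uv_ge0) // dotE (bigD1 i) //=.
by rewrite gerDl sumr_le0.
Qed.

Lemma lev_subr0 n (u v : 'cV[R]_n) : (u <=v v) <-> (u - v <=v 0).
Proof. by split=> uv i; have := uv i; rewrite !mxE subr_le0. Qed.

Lemma lev_col_mx m n (u : 'cV[R]_m) (v : 'cV[R]_n) :
  (col_mx u v <=v 0) <-> (u <=v 0) /\ (v <=v 0).
Proof.
split=> [uv|uv i].
  by split=> i; [have := uv (lshift n i) | have := uv (rshift m i)];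
    rewrite (col_mxEu, col_mxEd) !mxE.
case: uv => u_le0 v_le0; have [l ->|l ->] := split_ordP i.
  by have := u_le0 l; rewrite col_mxEu !mxE.
by have := v_le0 l; rewrite col_mxEd !mxE.
Qed.

Lemma usubmx_ge0 m n (u : 'cV[R]_(m + n)) : 0 <=v u -> 0 <=v usubmx u.
Proof. by move=> u0 i; have := u0 (lshift n i); rewrite !mxE. Qed.

Lemma dsubmx_ge0 m n (u : 'cV[R]_(m + n)) : 0 <=v u -> 0 <=v dsubmx u.
Proof. by move=> u0 i; have := u0 (rshift m i); rewrite !mxE. Qed.

Lemma lev_const_mx (a : R) : ((const_mx a : 'cV[R]_1) <=v 0) <-> a <= 0.
Proof. by split=> [a0|a0 i]; [have := a0 0|]; rewrite !mxE. Qed.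

End VectorFacts.

(** * Model (II) as a system of stacked inequalities *)

Section Duality.
Variables (R : realType) (M : model R).
Implicit Types (x : decision M) (y : multipliers M) (k : scenario M).

Let cG := 'cV[R]_(ngen M).

(** Products and function spaces carry a module structure, which the record [decision] lacks and the
    duality lemma needs. *)
Definition dvec : lmodType R :=
  (cG * cG * cG * (scenario M -> cG) * (scenario M -> cG)
   * (scenario M -> 'cV[R]_(nload M)))%type.

Definition decision_of (v : dvec) : decision M :=
  Decision v.1.1.1.1.1 v.1.1.1.1.2 v.1.1.1.2 v.1.1.2 v.1.2 v.2.

Definition dvec_of x : dvec := (gen x, rU x, rD x, dgU x, dgD x, shed x).

Lemma dvec_ofK : cancel dvec_of decision_of.
Proof. by case. Qed.

(* A balance equation becomes two opposite inequalities. *)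
Definition con_base x :=
  let e := Defs.total (load M) - Defs.total (gen x) in
  col_mx (col_mx (const_mx e : 'cV_1) (const_mx (- e) : 'cV_1))
  (col_mx (SG M *m gen x - SD M *m load M - flim M)
  (col_mx (Gmin M + rD x - gen x)
  (col_mx (gen x + rU x - Gmax M)
  (col_mx (0 - rU x)
  (col_mx (rU x - rUmax M)
  (col_mx (0 - rD x)
          (rD x - rDmax M))))))).

Definition con_scenario x k :=
  let e := Defs.total (load_s x k) - Defs.total (gen_s x k) in
  col_mx (col_mx (const_mx e : 'cV_1) (const_mx (- e) : 'cV_1))
  (col_mx (SG_s k *m gen_s x k - SD_s k *m load_s x k - flim_s k)
  (col_mx (0 - dgU x k)
  (col_mx (dgU x k - rU x)
  (col_mx (0 - dgD x k)
  (col_mx (dgD x k - rD x)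
  (col_mx (0 - shed x k)
          (shed x k - (load M + fluct k)))))))).

Lemma balance_lev (a b : R) : a = b <->
  (col_mx (const_mx (b - a) : 'cV_1) (const_mx (- (b - a)) : 'cV_1) <=v 0).
Proof.
rewrite lev_col_mx !lev_const_mx oppr_le0.
split=> [->|[ba ab]]; first by rewrite subrr.
by apply/esym/eqP; rewrite -subr_eq0 eq_le ba.
Qed.

Lemma feasible_baseE x : feasible_base x <-> (con_base x <=v 0).
Proof.
rewrite /con_base lev_col_mx -balance_lev; split.
  by case=> *; rewrite !lev_col_mx -!lev_subr0; do !split.
case=> ?; rewrite !lev_col_mx -!lev_subr0 => -[? [? [? [? [? [? ?]]]]]].
by split.
Qed.

Lemma feasible_scenarioE x k :
  feasible_scenario x k <-> (con_scenario x k <=v 0).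
Proof.
rewrite /con_scenario lev_col_mx -balance_lev; split.
  by case=> *; rewrite !lev_col_mx -!lev_subr0; do !split.
case=> ?; rewrite !lev_col_mx -!lev_subr0 => -[? [? [? [? [? [? ?]]]]]].
by split.
Qed.

Local Notation dim_base := (1 + 1 + (nline M + (ngen M + (ngen M
  + (ngen M + (ngen M + (ngen M + ngen M)))))))%N.

Local Notation dim_scenario k := (1 + 1 + (nline_s k + (ngen M + (ngen M
  + (ngen M + (ngen M + (nload M + nload M)))))))%N.

(** The slices follow the block order of [con_base] and [con_scenario]. The free multiplier of a
    balance equation is the difference of the nonnegative multipliers of its two inequalities. *)
Definition multipliers_of (yb : 'cV[R]_dim_base)
    (ys : forall k, 'cV[R]_(dim_scenario k)) : multipliers M :=
  let b := dsubmx yb in let s k := dsubmx (ys k) in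
  {| lam := usubmx (usubmx yb) 0 0 - dsubmx (usubmx yb) 0 0;
     mu := usubmx b;
     ups_lo := usubmx (dsubmx b);
     ups_up := usubmx (dsubmx (dsubmx b));
     rhoU_lo := usubmx (dsubmx (dsubmx (dsubmx b)));
     rhoU_up := usubmx (dsubmx (dsubmx (dsubmx (dsubmx b))));
     rhoD_lo := usubmx (dsubmx (dsubmx (dsubmx (dsubmx (dsubmx b)))));
     rhoD_up := dsubmx (dsubmx (dsubmx (dsubmx (dsubmx (dsubmx b)))));
     lam_s k := usubmx (usubmx (ys k)) 0 0 - dsubmx (usubmx (ys k)) 0 0;
     mu_s k := usubmx (s k);
     alpha_lo k := usubmx (dsubmx (s k));
     alpha_up k := usubmx (dsubmx (dsubmx (s k)));
     beta_lo k := usubmx (dsubmx (dsubmx (dsubmx (s k))));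
     beta_up k := usubmx (dsubmx (dsubmx (dsubmx (dsubmx (s k)))));
     tau_lo k := usubmx (dsubmx (dsubmx (dsubmx (dsubmx (dsubmx (s k))))));
     tau_up k := dsubmx (dsubmx (dsubmx (dsubmx (dsubmx (dsubmx (s k)))))) |}.

Lemma multipliers_of_ge0 yb ys :
  0 <=v yb -> (forall k, 0 <=v ys k) -> dual_feasible (multipliers_of yb ys).
Proof.
move=> yb0 ys0; split => *; rewrite /=;
  by do ?[apply: usubmx_ge0 | apply: dsubmx_ge0].
Qed.

Lemma lagrangian_of x yb ys :
  lagrangian x (multipliers_of yb ys)
  = cost x + dot yb (con_base x) + \sum_k dot (ys k) (con_scenario x k).
Proof.
rewrite /lagrangian; congr (_ + _ + _).
  by rewrite /con_base !dot_col_mx !dot_const_mx1 mulrN -mulrBl !addrA.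
apply: eq_bigr => k _.
by rewrite /con_scenario !dot_col_mx !dot_const_mx1 mulrN -mulrBl !addrA.
Qed.

(** * Affinity of the cost and of the constraints *)

Lemma affine_total n (V : lmodType R) (f : V -> 'cV[R]_n) :
  affine f -> affine (fun v => Defs.total (f v) : R^o).
Proof. by move=> af; apply: affine_sum => i; apply: affine_entry. Qed.

Lemma affine_dot n (V : lmodType R) (u : 'cV[R]_n) (f : V -> 'cV[R]_n) :
  affine f -> affine (fun v => dot u (f v) : R^o).
Proof. by move=> af; apply/affine_entry/affine_mulmx. Qed.

Lemma affine_gen : affine (fun v => gen (decision_of v)).
Proof. do 5 apply: affine_fst; exact: affine_id. Qed.

Lemma affine_rU : affine (fun v => rU (decision_of v)).
Proof. apply: affine_snd; do 4 apply: affine_fst; exact: affine_id. Qed.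

Lemma affine_rD : affine (fun v => rD (decision_of v)).
Proof. apply: affine_snd; do 3 apply: affine_fst; exact: affine_id. Qed.

Lemma affine_dgU k : affine (fun v => dgU (decision_of v) k).
Proof.
apply: (@affine_app _ _ _ _ (fun v : dvec => v.1.1.2)).
apply: affine_snd; do 2 apply: affine_fst; exact: affine_id.
Qed.

Lemma affine_dgD k : affine (fun v => dgD (decision_of v) k).
Proof.
apply: (@affine_app _ _ _ _ (fun v : dvec => v.1.2)).
by apply: affine_snd; apply: affine_fst; exact: affine_id.
Qed.

Lemma affine_shed k : affine (fun v => shed (decision_of v) k).
Proof.
apply: (@affine_app _ _ _ _ (fun v : dvec => v.2)).
by apply: affine_snd; exact: affine_id.
Qed.

Lemma affine_gen_s k : affine (fun v => gen_s (decision_of v) k).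
Proof.
apply: affineB; last exact: affine_dgD.
by apply: affineD; [exact: affine_gen | exact: affine_dgU].
Qed.

Lemma affine_load_s k : affine (fun v => load_s (decision_of v) k).
Proof. by apply: affineB; [exact: affine_cst | exact: affine_shed]. Qed.

Lemma affine_cost : affine (fun v => cost (decision_of v) : R^o).
Proof.
apply: affineD; last first.
  apply: affine_sum => k; apply: affineZ; apply: affineD; [apply: affineB|];
    apply: affine_dot; [exact: affine_dgU|exact: affine_dgD|exact: affine_shed].
apply: affineD; [apply: affineD|]; apply: affine_dot;
  [exact: affine_gen|exact: affine_rU|exact: affine_rD].
Qed.

Lemma affine_balance n n' (V : lmodType R) (f : V -> 'cV[R]_n)
    (g : V -> 'cV[R]_n') : affine f -> affine g ->
  affine (fun v =>
    col_mx (const_mx (Defs.total (f v) - Defs.total (g v)) : 'cV_1)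
           (const_mx (- (Defs.total (f v) - Defs.total (g v))) : 'cV_1)).
Proof.
move=> /affine_total af /affine_total ag.
have ae := affineB af ag.
by apply: affine_col_mx; apply: affine_const_mx => //; exact: affineN.
Qed.

Lemma affine_con_base : affine (fun v => con_base (decision_of v)).
Proof.
have ac n (u : 'cV[R]_n) : affine (fun _ : dvec => u) by exact: affine_cst.
have aG := affine_gen; have aU := affine_rU; have aD := affine_rD.
apply: affine_col_mx; first exact: (affine_balance (ac _ _) aG).
apply: affine_col_mx.
  exact: (affineB (affineB (affine_mulmx _ aG) (ac _ _)) (ac _ _)).
apply: affine_col_mx; first exact: (affineB (affineD (ac _ _) aD) aG).
apply: affine_col_mx; first exact: (affineB (affineD aG aU) (ac _ _)).
apply: affine_col_mx; first exact: (affineB (ac _ _) aU).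
apply: affine_col_mx; first exact: (affineB aU (ac _ _)).
apply: affine_col_mx; first exact: (affineB (ac _ _) aD).
exact: (affineB aD (ac _ _)).
Qed.

Lemma affine_con_scenario k :
  affine (fun v => con_scenario (decision_of v) k).
Proof.
have ac n (u : 'cV[R]_n) : affine (fun _ : dvec => u) by exact: affine_cst.
have aU := affine_rU; have aD := affine_rD.
have aP := affine_dgU k; have aN := affine_dgD k; have aS := affine_shed k.
have aG := affine_gen_s k; have aL := affine_load_s k.
apply: affine_col_mx; first exact: (affine_balance aL aG).
apply: affine_col_mx.
  exact: (affineB (affineB (affine_mulmx _ aG) (affine_mulmx _ aL)) (ac _ _)).
apply: affine_col_mx; first exact: (affineB (ac _ _) aP).
apply: affine_col_mx; first exact: (affineB aP aU).
apply: affine_col_mx; first exact: (affineB (ac _ _) aN).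
apply: affine_col_mx; first exact: (affineB aN aD).
apply: affine_col_mx; first exact: (affineB (ac _ _) aS).
exact: (affineB aS (ac _ _)).
Qed.

(** * Strong duality and optimal multipliers *)

Lemma strong_duality x : primal_optimal x ->
  exists2 y, dual_feasible y & forall x', cost x <= lagrangian x' y.
Proof.
case=> [[xb xs] x_min].
pose J k := 'I_(dim_scenario k).
(* All constraint rows form one finite family; the scenario rows need a dependent sum because their
   number varies with [k]. *)
pose g (i : 'I_dim_base + {k & J k}) v : R := match i with
  | inl i => con_base (decision_of v) i 0
  | inr (existT k i) => con_scenario (decision_of v) k i 0
  end.
have [||||z z_ge0 zP] := @affine_duality R dvec _ g
  (fun v => cost (decision_of v)) (dvec_of x).
- case=> [i|[k i]].
    exact: (affine_entry i 0 affine_con_base).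
  exact: (affine_entry i 0 (@affine_con_scenario k)).
- exact: affine_cost.
- rewrite /g dvec_ofK => -[i|[k i]].
    by have /feasible_baseE/(_ i) := xb; rewrite [in X in _ <= X]mxE.
  by have /feasible_scenarioE/(_ i) := xs k; rewrite [in X in _ <= X]mxE.
- move=> v v_le0; rewrite dvec_ofK; apply: x_min; split=> [|k].
    apply/feasible_baseE => i; rewrite [in X in _ <= X]mxE.
    exact: (v_le0 (inl i)).
  apply/feasible_scenarioE => i; rewrite [in X in _ <= X]mxE.
  exact: (v_le0 (inr (Tagged J i))).
exists (multipliers_of (\col_i z (inl i))
    (fun k => \col_i z (inr (Tagged J i)))) => [|x'].
  by apply: multipliers_of_ge0 => [i|k i]; rewrite !mxE.
have := zP (dvec_of x'); rewrite !dvec_ofK lagrangian_of => /le_trans; apply.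
rewrite -(addrA (cost x')) lerD2l big_sumType /=.
have -> : \sum_(p : {k & J k}) z (inr p) * g (inr p) (dvec_of x') =
    \sum_k \sum_(i < dim_scenario k)
      z (inr (Tagged J i)) * g (inr (Tagged J i)) (dvec_of x').
  by rewrite sig_big_dep /=; apply: eq_bigr => -[].
rewrite /g /= dvec_ofK lerD //.
  by rewrite dotE ler_sum // => i _; rewrite mxE.
by apply: ler_sum => k _; rewrite dotE ler_sum // => i _; rewrite mxE.
Qed.

(** Strong duality provides some [z] with dual value at least [cost x]. The dual value of [y] is no
    smaller, and it bounds the Lagrangian from below at every decision. *)
Lemma optimal_multipliers x y : primal_optimal x -> dual_optimal y ->
  forall x', cost x <= lagrangian x' y.
Proof.
move=> /strong_duality[z z_ge0 zP] [_ y_max] x'.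
rewrite -lee_fin; apply: (@le_trans _ _ (dual_value z)).
  by apply: le_ereal_inf_tmp => _ [x'' _ <-]; rewrite lee_fin.
by apply: (le_trans (y_max _ z_ge0)); apply: ereal_inf_lbound; exists x'.
Qed.

(** * Complementary slackness for upward re-dispatch *)

Lemma lagrangian_base_le0 x y :
  feasible_base x -> dual_feasible y -> lagrangian_base x y <= 0.
Proof.
case=> xb xl xg xG xU xU' xD xD' [] *.
rewrite /lagrangian_base xb subrr mulr0 add0r.
by rewrite !addr_le0 // dot_le0 // -lev_subr0.
Qed.

(** Only nonpositive terms are discarded; the two bounds on [dgU] are kept so that their slackness
    can be read off. *)
Lemma lagrangian_scenario_le x y k :
  feasible_scenario x k -> dual_feasible y ->
  lagrangian_scenario x y k <=
    dot (alpha_lo y k) (0 - dgU x k) + dot (alpha_up y k) (dgU x k - rU x).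
Proof.
case=> xb xl xP xP' xN xN' xS xS' y_ge0; rewrite /lagrangian_scenario xb.
rewrite subrr mulr0 add0r.
have ml : dot (mu_s y k)
    (SG_s k *m gen_s x k - SD_s k *m load_s x k - flim_s k) <= 0.
  by apply: dot_le0; [exact: mu_s_ge0 | rewrite -lev_subr0].
have bl : dot (beta_lo y k) (0 - dgD x k) <= 0.
  by apply: dot_le0; [exact: beta_lo_ge0 | rewrite -lev_subr0].
have bu : dot (beta_up y k) (dgD x k - rD x) <= 0.
  by apply: dot_le0; [exact: beta_up_ge0 | rewrite -lev_subr0].
have tl : dot (tau_lo y k) (0 - shed x k) <= 0.
  by apply: dot_le0; [exact: tau_lo_ge0 | rewrite -lev_subr0].
have tu : dot (tau_up y k) (shed x k - (load M + fluct k)) <= 0.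
  by apply: dot_le0; [exact: tau_up_ge0 | rewrite -lev_subr0].
lra.
Qed.

Lemma alpha_slackness x y k i : primal_optimal x -> dual_optimal y ->
  alpha_lo y k i 0 * dgU x k i 0 = 0 /\
  alpha_up y k i 0 * (dgU x k i 0 - rU x i 0) = 0.
Proof.
move=> xO yO; have [[xb xs] _] := xO; have [y_ge0 _] := yO.
have lo_le0 l : dot (alpha_lo y l) (0 - dgU x l) <= 0.
  by apply: dot_le0; [exact: alpha_lo_ge0 | rewrite -lev_subr0; case: (xs l)].
have up_le0 l : dot (alpha_up y l) (dgU x l - rU x) <= 0.
  by apply: dot_le0; [exact: alpha_up_ge0 | rewrite -lev_subr0; case: (xs l)].
have := optimal_multipliers xO yO x.
have := lagrangian_base_le0 xb y_ge0.
have : \sum_(l | l != k) lagrangian_scenario x y l <= 0.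
  apply: sumr_le0 => l _.
  apply: le_trans (lagrangian_scenario_le (xs l) y_ge0) _.
  by rewrite addr_le0.
have := lagrangian_scenario_le (xs k) y_ge0.
rewrite /lagrangian [\sum_l lagrangian_scenario x y l](bigD1 k) //=.
move=> s_le r_le b_le L_ge.
have lo0 := lo_le0 k; have up0 := up_le0 k.
(* All other terms added to the cost are at most 0, so [cost x <= lagrangian x y] makes the sum of
   these two nonpositive products nonnegative. *)
have lo_ge0 : 0 <= dot (alpha_lo y k) (0 - dgU x k) by lra.
have up_ge0 : 0 <= dot (alpha_up y k) (dgU x k - rU x) by lra.
split.
  have := dot_eq0 i (alpha_lo_ge0 y_ge0 k) _ lo_ge0.
  rewrite -lev_subr0 !mxE sub0r mulrN => /(_ (dgU_ge0 (xs k)))/eqP.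
  by rewrite oppr_eq0 => /eqP.
have := dot_eq0 i (alpha_up_ge0 y_ge0 k) _ up_ge0.
by rewrite -lev_subr0 !mxE => /(_ (dgU_le (xs k))).
Qed.

(** * Stationarity in upward re-dispatch *)

(** The result may be infeasible, which is harmless: the Lagrangian bound holds for all
    decisions. *)
Definition bump x k i (t : R) : decision M :=
  Decision (gen x) (rU x) (rD x)
    (fun l => dgU x l + (if l == k then t else 0) *: delta_mx i 0)
    (dgD x) (shed x).

Lemma sum_bump (F G : scenario M -> R) k t :
  \sum_l (F l + (if l == k then t else 0) * G l) = \sum_l F l + t * G k.
Proof.
rewrite big_split /= [X in _ + X](bigD1 k) //= eqxx.
rewrite [X in t * G k + X]big1 ?addr0 //.
by move=> l /negbTE->; rewrite mul0r.
Qed.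

Lemma cost_bump x k i t :
  cost (bump x k i t) = cost x + t * (prob k * cup M i 0).
Proof.
rewrite /cost /= -[RHS]addrA -(sum_bump _ (fun l => prob l * cup M i 0)).
congr (_ + _); apply: eq_bigr => l _.
rewrite dotDr dotZr dot_delta; move: (if _ then _ else _) => s; ring.
Qed.

(** Extra output at [i] enters the balance with weight [- lam_s] and the line flows through its
    shift-factor column; together these give [- omega]. *)
Lemma lagrangian_scenario_bump x y k i t l :
  lagrangian_scenario (bump x k i t) y l = lagrangian_scenario x y l
  + (if l == k then t else 0)
    * (alpha_up y l i 0 - alpha_lo y l i 0 - omega y l (gbus i)).
Proof.
set s := if _ then _ else _.
have gE : gen_s (bump x k i t) l = gen_s x l + s *: delta_mx i 0.
  by rewrite /gen_s /= -/s [gen x + (_ + _)]addrA [LHS]addrAC.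
rewrite /lagrangian_scenario /load_s gE /= -/s; clearbody s.
rewrite /omega mulmxDr -scalemxAr.
have -> : Defs.total (gen_s x l + s *: delta_mx i 0)
    = Defs.total (gen_s x l) + s.
  rewrite /Defs.total.
  rewrite (eq_bigr (fun j => gen_s x l j 0 + (if j == i then s else 0))).
    by rewrite big_split /= -big_mkcond big_pred1_eq.
  by move=> j _; rewrite !mxE andbT; case: eqP; rewrite (mulr1, mulr0).
rewrite !dotDr !dotNr !dotDr !dotZr !dot_delta dot_mulmxr.
(* Here the generator is replaced by its bus, which makes the price common to all generators
   there. *)
have -> : col i (SG_s l) = col (gbus i) (shiftG_s l).
  by apply/matrixP => p q; rewrite !mxE.
ring.
Qed.

Lemma lagrangian_bump x y k i t :
  lagrangian (bump x k i t) y = lagrangian x y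
  + t * (prob k * cup M i 0 + alpha_up y k i 0 - alpha_lo y k i 0
         - omega y k (gbus i)).
Proof.
rewrite /lagrangian cost_bump.
under eq_bigr do rewrite lagrangian_scenario_bump.
rewrite (sum_bump _
  (fun l => alpha_up y l i 0 - alpha_lo y l i 0 - omega y l (gbus i))).
(* The base part does not involve re-dispatch, so both sides are convertible. *)
rewrite (_ : lagrangian_base (bump x k i t) y = lagrangian_base x y) //.
ring.
Qed.

Lemma dgU_stationarity x y k i : primal_optimal x -> dual_optimal y ->
  prob k * cup M i 0 + alpha_up y k i 0 - alpha_lo y k i 0 = omega y k (gbus i).
Proof.
move=> xO yO; have L_ge := optimal_multipliers xO yO.
have L_le : lagrangian x y <= cost x.
  have [[xb xs] _] := xO; have [y_ge0 _] := yO.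
  rewrite /lagrangian -(addrA (cost x)) gerDl addr_le0 ?lagrangian_base_le0 //.
  apply: sumr_le0 => l _.
  apply: le_trans (lagrangian_scenario_le (xs l) y_ge0) _.
  by apply: addr_le0; apply: dot_le0;
    [exact: alpha_lo_ge0| |exact: alpha_up_ge0|];
    rewrite -lev_subr0; case: (xs l).
(* Steps of +1 and -1 cannot bring the Lagrangian below [cost x], which bounds its value at [x] from
   above; being affine in [t], it has slope zero. *)
have := L_ge (bump x k i 1); have := L_ge (bump x k i (- 1)).
rewrite !lagrangian_bump; lra.
Qed.

(** * Revenue per unit of upward re-dispatch *)

Lemma PiU_ratio x y k i : primal_optimal x -> dual_optimal y ->
  0 < dgU x k i 0 -> PiU x y k i / dgU x k i 0 = omega y k (gbus i).
Proof.
move=> xO yO i_gt0; have [lo0 up0] := alpha_slackness k i xO yO.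
rewrite -(dgU_stationarity k i xO yO) /PiU /GammaU /PhiU.
have -> : alpha_lo y k i 0 = 0.
  by move/eqP: lo0; rewrite mulf_eq0 (gt_eqF i_gt0) orbF => /eqP.
(* By slackness, reserve is credited only where it is fully dispatched, so [dgU] can replace [rU]
   and then cancels in the quotient. *)
have -> : alpha_up y k i 0 * rU x i 0 = alpha_up y k i 0 * dgU x k i 0 by lra.
by field; rewrite gt_eqF.
Qed.

End Duality.

Theorem theorem2 (R : realType) (M : model R)
    (x : decision M) (y : multipliers M)
    (hx : primal_optimal x) (hy : dual_optimal y)
    (k : scenario M) (i j : 'I_(ngen M))
    (hij : gbus i = gbus j)
    (hi : 0 < dgU x k i 0) (hj : 0 < dgU x k j 0) :
  [/\ PiU x y k i / dgU x k i 0 = PiU x y k j / dgU x k j 0,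
      PiU x y k j / dgU x k j 0 = omega y k (gbus i)
    & omega y k (gbus i) = omega y k (gbus j)].
Proof.
by rewrite (PiU_ratio hx hy hi) (PiU_ratio hx hy hj) hij.
Qed.
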